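(* Let $r$ be a nonnegative integer. For all integers $m,n,k\geq 0$ with $n\geq m+k$, we have $$\binom{m+k}{m}T_r(n+r,m+k+r)=\sum_{l=m}^{n-k}\binom{n}{l}T_r(l+r,m+r)\,T(n-l,k).$$
   Context: Central factorials: $x^{[0]}=1$ and, for $n\ge 1$, $x^{[n]}=x\prod_{j=1}^{n-1}\left(x+\frac n2-j\right)=x\left(x+\frac n2-1\right)\left(x+\frac n2-2\right)\cdots\left(x-\frac n2+1\right)$. The central factorial numbers of the second kind $T(n,k)$ ($0\le k\le n$) are defined by $x^n=\sum_{k=0}^n T(n,k)x^{[k]}$ for all $n\ge 0$; equivalently (well known), by the formal power series identity $\frac{1}{k!}\left(e^{t/2}-e^{-t/2}\right)^k=\sum_{n=k}^\infty T(n,k)\frac{t^n}{n!}$ for $k\ge 0$. For a nonnegative integer $r$, the extended $r$-central factorial numbers of the second kind $T_r(n+r,k+r)$ ($n\ge k\ge 0$) are defined by the formal power series identity $$\frac{1}{k!}e^{rt}\left(e^{t/2}-e^{-t/2}\right)^k=\sum_{n=k}^\infty T_r(n+r,k+r)\frac{t^n}{n!},\qquad k\ge 0.$$ *)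

(* Defs.v *)
From mathcomp Require Import all_boot all_order all_algebra.

Set Implicit Arguments.
Unset Strict Implicit.
Unset Printing Implicit Defensive.

Import Order.TTheory GRing.Theory Num.Theory.
Local Open Scope ring_scope.

(* x^[n], as a polynomial in the indeterminate x = 'X. *)
Definition cfact (n : nat) : {poly rat} :=
  if n is 0 then 1
  else 'X * \prod_(1 <= j < n) ('X + (n%:R / 2%:R - j%:R)%:P).

(* A formal power series in t is its sequence of coefficients; equality of
   series is the pointwise equality =1. *)
Definition fps := nat -> rat.

Definition fps_one : fps := fun n => (n == 0)%:R.

Definition fps_sub (f g : fps) : fps := fun n => f n - g n.

Definition fps_scale (c : rat) (f : fps) : fps := fun n => c * f n.

(* Cauchy product *)
Definition fps_mul (f g : fps) : fps :=
  fun n => \sum_(i < n.+1) f i * g (n - i)%N.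

Definition fps_pow (f : fps) (k : nat) : fps := iter k (fps_mul f) fps_one.

(* exp (a t) *)
Definition fps_exp (a : rat) : fps := fun n => a ^+ n / n`!%:R.

(* Only the values T n k with k <= n are constrained (and they are determined,
   the cfact k being monic of degree k). *)
Definition central_factorial2 (T : nat -> nat -> rat) : Prop :=
  forall n : nat, 'X^n = \sum_(0 <= k < n.+1) T n k *: cfact k.

(* Tr takes the shifted arguments n + r and k + r; only its values there with
   k <= n are constrained (and determined). *)
Definition r_central_factorial2 (r : nat) (Tr : nat -> nat -> rat) : Prop :=
  forall k : nat,
    fps_scale (k`!%:R^-1)
      (fps_mul (fps_exp r%:R)
         (fps_pow (fps_sub (fps_exp (1 / 2%:R)) (fps_exp (- (1 / 2%:R)))) k))
    =1 (fun n => if (k <= n)%N then Tr (n + r)%N (k + r)%N / n`!%:R else 0).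

(* Both defining identities are satisfiable. *)

Lemma cfact_monic (n : nat) : size (cfact n) = n.+1 /\ cfact n \is monic.
Proof.
case: n => [|n]; first by rewrite size_poly1 monic1.
have -> : cfact n.+1 = 'X * \prod_(1 <= j < n.+1)
    ('X - (- (n.+1%:R / 2%:R - j%:R))%:P).
  by congr (_ * _); apply: eq_bigr => j _; rewrite polyCN opprK.
have mP : \prod_(1 <= j < n.+1)
    ('X - (- (n.+1%:R / 2%:R - j%:R) : rat)%:P) \is monic.
  exact: monic_prod_XsubC.
split; last by rewrite monicMl ?monicX.
by rewrite size_monicM ?monicX ?monic_neq0 // size_polyX size_prod_XsubC
  size_iota subn1.
Qed.

Lemma cfact_span (n : nat) (p : {poly rat}) : (size p <= n)%N ->
  {c : nat -> rat | p = \sum_(0 <= k < n) c k *: cfact k}.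
Proof.
elim: n p => [|n IHn] p sp.
  by exists (fun=> 0); rewrite big_nil; apply/eqP; rewrite -size_poly_leq0.
have [sc /monicP mc] := cfact_monic n.
have lc : (cfact n)`_n = 1 by rewrite -[RHS]mc lead_coefE sc.
have /IHn [c Ec] : (size (p - p`_n *: cfact n)%R <= n)%N.
  apply/leq_sizeP => j; rewrite leq_eqVlt coefB coefZ => /predU1P[<-|nj].
    by rewrite lc mulr1 subrr.
  have -> : p`_j = 0 by apply: nth_default; apply: leq_trans sp nj.
  have -> : (cfact n)`_j = 0 by apply: nth_default; rewrite sc.
  by rewrite mulr0 subrr.
exists (fun k => if (k < n)%N then c k else p`_n).
rewrite big_nat_recr //= ltnn -[LHS](subrK (p`_n *: cfact n)) Ec.
by congr (_ + _); apply: eq_big_nat => k /andP[_ ->].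
Qed.

Lemma central_factorial2_exists : exists T, central_factorial2 T.
Proof.
have sX n : (size ('X^n : {poly rat}) <= n.+1)%N by rewrite size_polyXn.
exists (fun n => sval (cfact_span (sX n))) => n.
exact: (svalP (cfact_span (sX n))).
Qed.

Lemma fps_pow_lt (f : fps) (k n : nat) :
  f 0%N = 0 -> (n < k)%N -> fps_pow f k n = 0.
Proof.
move=> f0; elim: k n => // k IHk n nk.
rewrite /fps_pow iterS -/(fps_pow f k); apply: big1 => -[[|i] /= ilt] _.
  by rewrite f0 mul0r.
rewrite IHk ?mulr0 //.
by case: n nk ilt => // n nk _; rewrite subSS (leq_ltn_trans (leq_subr i n)).
Qed.

Lemma r_central_factorial2_exists (r : nat) :
  exists Tr, r_central_factorial2 r Tr.
Proof.
pose f := fps_sub (fps_exp (1 / 2%:R)) (fps_exp (- (1 / 2%:R))).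
pose G k := fps_scale (k`!%:R^-1) (fps_mul (fps_exp r%:R) (fps_pow f k)).
exists (fun n k => G (k - r)%N (n - r)%N * (n - r)`!%:R) => k n.
rewrite -/f -/(G k) !addnK mulfK ?pnatr_eq0 -?lt0n ?fact_gt0 //.
case: leqP => // nk; rewrite /G /fps_scale /fps_mul big1 ?mulr0 // => i _.
rewrite fps_pow_lt ?mulr0 ?(leq_ltn_trans (leq_subr i n)) //.
Qed.

(* Main.v *)
Require Import Defs.
From HB Require Import structures.
From mathcomp Require Import all_boot all_order all_algebra.
From mathcomp Require Import ring.

Import Order.TTheory GRing.Theory Num.Theory.
Local Open Scope ring_scope.

(* Let f = e^(t/2) - e^(-t/2).  The identity is the coefficient of t^n in
   (e^(rt) f^m) f^k = e^(rt) f^(m+k), once the numbers T are known to have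
   generating functions f^k / k!.  For the latter, let delta be the central
   difference p(x + 1/2) - p(x - 1/2).  Since delta x^[n] = n x^[n-1],
   evaluating delta^k at 0 on x^n = \sum_j T(n,j) x^[j] gives k! T(n,k), whereas
   the binomial formula gives n! times the coefficient of t^n in f^k. *)

Lemma eq_fps_mul (f f' g g' : fps) :
  f =1 f' -> g =1 g' -> fps_mul f g =1 fps_mul f' g'.
Proof. by move=> ff' gg' n; apply: eq_bigr => i _; rewrite ff' gg'. Qed.

Lemma coefM_fps_mul (f g : fps) (p q : {poly rat}) (n : nat) :
  (forall i, (i <= n)%N -> p`_i = f i) -> (forall i, (i <= n)%N -> q`_i = g i) ->
  forall i, (i <= n)%N -> (p * q)`_i = fps_mul f g i.
Proof.
move=> pf qg i le_in; rewrite coefM; apply: eq_bigr => -[j /= lt_ji] _.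
by rewrite pf ?qg ?(leq_trans _ le_in) // leq_subr.
Qed.

(** Associativity is borrowed from polynomials: coefficient [n] of either side involves only
    coefficients of index at most [n], so each series may be replaced by its truncation [tr]. *)
Lemma fps_mulA (f g h : fps) :
  fps_mul f (fps_mul g h) =1 fps_mul (fps_mul f g) h.
Proof.
move=> n; pose tr (u : fps) : {poly rat} := \poly_(i < n.+1) u i.
have trE u i : (i <= n)%N -> (tr u)`_i = u i by rewrite coef_poly ltnS => ->.
rewrite -(@coefM_fps_mul _ _ (tr f) (tr g * tr h) n) ?mulrA //.
- by apply: (@coefM_fps_mul _ _ _ _ n) => // *; rewrite ?trE //;
    apply: (@coefM_fps_mul _ _ _ _ n) => // *; rewrite trE.
- exact: trE.
by apply: coefM_fps_mul => *; rewrite trE.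
Qed.

Lemma fps_mul1l (f : fps) : fps_mul fps_one f =1 f.
Proof.
move=> n; rewrite /fps_mul big_ord_recl /= subn0 mul1r big1 ?addr0 // => i _.
by rewrite mul0r.
Qed.

Lemma fps_powD (f : fps) (m k : nat) :
  fps_pow f (m + k) =1 fps_mul (fps_pow f m) (fps_pow f k).
Proof.
elim: m => [|m IHm] n; first by rewrite fps_mul1l.
by rewrite /= -fps_mulA; apply: eq_fps_mul.
Qed.

Definition central_diff (p : {poly rat}) : {poly rat} :=
  (p \Po ('X + (1 / 2%:R)%:P)) - (p \Po ('X + (- (1 / 2%:R))%:P)).

(** The series f of the overview, that is, 2 sinh(t/2). *)
Definition fps_sinh2 : fps :=
  fps_sub (fps_exp (1 / 2%:R)) (fps_exp (- (1 / 2%:R))).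

Lemma central_diff_is_linear : linear central_diff.
Proof.
move=> a p q; rewrite /central_diff !comp_polyD !comp_polyZ scalerBr opprD.
by rewrite addrACA.
Qed.

HB.instance Definition _ :=
  GRing.isLinear.Build rat {poly rat} {poly rat} *:%R central_diff
    central_diff_is_linear.

Lemma iter_central_diff_sum (k : nat) (I : Type) (s : seq I) (c : I -> rat)
    (p : I -> {poly rat}) :
  iter k central_diff (\sum_(i <- s) c i *: p i) =
  \sum_(i <- s) c i *: iter k central_diff (p i).
Proof.
elim: k => //= k ->; rewrite linear_sum; apply: eq_bigr => i _.
by rewrite linearZ.
Qed.

(** For n > 0 the two shifts of x^[n+1] share all but two of their linear factors; the remaining
    quadratics differ by (n+1) x, and x completes the shared product to x^[n]. *)
Lemma central_diff_cfact (n : nat) :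
  central_diff (cfact n.+1) = n.+1%:R *: cfact n.
Proof.
have shift a : cfact n.+1 \Po ('X + a%:P) = ('X + a%:P) *
    \prod_(1 <= j < n.+1) ('X + (a + n.+1%:R / 2%:R - j%:R)%:P).
  rewrite /cfact comp_polyM comp_polyX rmorph_prod; congr (_ * _).
  apply: eq_bigr => j _.
  by rewrite /= comp_polyD comp_polyX comp_polyC -addrA -polyCD addrA.
rewrite /central_diff !shift; case: n {shift} => [|n].
  rewrite !big_geq // !mulr1 scale1r opprD addrACA subrr add0r -polyCN -polyCD.
  by rewrite opprK -[RHS]/(1%:P); congr _%:P; field.
(* The factor j = 1 leaves the first product and j = n + 1 the second; what remains of either is
   [P]. *)
rewrite /cfact !big_add1 /= [X in _ * X - _]big_nat_recl //.
rewrite [X in _ - _ * X]big_nat_recr //=.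
pose P := \prod_(0 <= i < n) ('X + (n.+1%:R / 2%:R - i.+1%:R : rat)%:P).
rewrite [X in _ * (_ * X) - _](eq_bigr
    (fun i => 'X + (n.+1%:R / 2%:R - i.+1%:R : rat)%:P)); last first.
  move=> i _; congr (_ + _%:P).
  by rewrite -[i.+2]addn1 -[n.+2]addn1 !natrD; field.
rewrite [X in _ - _ * (X * _)](eq_bigr
    (fun i => 'X + (n.+1%:R / 2%:R - i.+1%:R : rat)%:P)); last first.
  by move=> i _; congr (_ + _%:P); rewrite -[n.+2]addn1 !natrD; field.
rewrite -/P -mul_polyC.
have -> : 1 / 2%:R + n.+2%:R / 2%:R - 1%:R = n.+1%:R * (1 / 2%:R) :> rat.
  by rewrite -[n.+2]addn1 natrD; field.
have -> : - (1 / 2%:R) + n.+2%:R / 2%:R - n.+1%:R =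
    - (n.+1%:R * (1 / 2%:R)) :> rat.
  by rewrite -[n.+2]addn1 natrD; field.
(* In this form the claim is [P] times (x + h)(x + c) - (x - h)(x - c) = (c + c + h + h) x, valid
   for arbitrary h and c. *)
have -> : n.+2%:R = n.+1%:R * (1 / 2%:R) + n.+1%:R * (1 / 2%:R) +
    (1 / 2%:R) + (1 / 2%:R) :> rat.
  by rewrite -[n.+2]addn1 natrD; field.
move: P (1 / 2%:R) (n.+1%:R * _) => P h c.
by rewrite !polyCD !polyCN; ring.
Qed.

Lemma horner0_cfact (n : nat) : (cfact n).[0] = (n == 0%N)%:R.
Proof. by case: n => [|n]; rewrite ?hornerC // hornerM hornerX mul0r. Qed.

Lemma horner0_iter_central_diff_cfact (k n : nat) :
  (iter k central_diff (cfact n)).[0] = if k == n then k`!%:R else 0.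
Proof.
elim: k n => [|k IHk] n; first by rewrite horner0_cfact; case: n.
rewrite iterSr; case: n => [|n].
  rewrite /central_diff !comp_polyC subrr.
  have -> : iter k central_diff 0 = 0 by elim: k {IHk} => //= k ->; apply: linear0.
  by rewrite horner0.
rewrite central_diff_cfact.
(* A one-term sum pulls the scalar n + 1 out of the iterated difference. *)
have := @iter_central_diff_sum k _ [:: tt] (fun=> n.+1%:R) (fun=> cfact n).
rewrite !big_seq1 => ->; rewrite hornerZ IHk eqSS.
by case: eqP => [->|_]; rewrite ?mulr0 // factS natrM.
Qed.

(** In the binomial expansions of (x + 1/2)^n and (x - 1/2)^n, the difference (1/2)^j - (-1/2)^j is
    j! times the coefficient of t^j in 2 sinh(t/2). *)
Lemma central_diffXn (n : nat) : central_diff 'X^n =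
  \sum_(i < n.+1) ('C(n, i)%:R * (n - i)`!%:R * fps_sinh2 (n - i)%N) *: 'X^i.
Proof.
have binom (a : rat) : ('X + a%:P) ^+ n =
    \sum_(i < n.+1) ('C(n, i)%:R * a ^+ (n - i)) *: 'X^i.
  rewrite ['X + _]addrC exprDn; apply: eq_bigr => i _.
  by rewrite -polyC_exp mul_polyC -scaler_nat scalerA.
rewrite /central_diff !comp_Xn_poly !binom -sumrB; apply: eq_bigr => i _.
rewrite -scalerBl -mulrBr -mulrA /fps_sinh2 /fps_sub /fps_exp -mulrBl.
by rewrite [_`!%:R * _]mulrC divfK // pnatr_eq0 -lt0n fact_gt0.
Qed.

Lemma horner0_iter_central_diffXn (k n : nat) :
  (iter k central_diff 'X^n).[0] = n`!%:R * fps_pow fps_sinh2 k n.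
Proof.
elim: k n => [|k IHk] n.
  by rewrite hornerXn expr0n /=; case: n => [|n]; rewrite ?mulr1 ?mulr0.
rewrite iterSr central_diffXn iter_central_diff_sum horner_sum.
rewrite -[fps_pow _ _ _]/(\sum_(j < n.+1) fps_sinh2 j * fps_pow fps_sinh2 k (n - j)%N).
rewrite mulr_sumr.
(* The Cauchy product is indexed by the degree n - i taken from the first factor, the expansion of
   the difference by the surviving power i. *)
rewrite [RHS](reindex_inj rev_ord_inj) /=; apply: eq_bigr => -[i /= le_in] _.
rewrite subSS hornerZ IHk subKn // -(@bin_fact n i) // !natrM; ring.
Qed.

Lemma central_factorial2_egf (T : nat -> nat -> rat) (k n : nat) :
  central_factorial2 T ->
  fps_pow fps_sinh2 k n =
  if (k <= n)%N then k`!%:R * (T n k / n`!%:R) else 0.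
Proof.
move=> hT; have nz : n`!%:R != 0 :> rat by rewrite pnatr_eq0 -lt0n fact_gt0.
apply: (mulfI nz); rewrite -horner0_iter_central_diffXn hT.
rewrite iter_central_diff_sum horner_sum.
under eq_bigr => j _ do rewrite hornerZ horner0_iter_central_diff_cfact.
(* Only j = k can contribute, and it lies in the summation range exactly when k <= n. *)
case: leqP => [le_kn | lt_nk]; last first.
  rewrite mulr0 big_nat big1 // => j /andP[_ lt_jn].
  by rewrite gtn_eqF ?mulr0 // (leq_trans lt_jn).
rewrite (bigD1_seq k) ?mem_index_iota ?iota_uniq //= eqxx big1 ?addr0.
  by field.
by move=> j /negPf ne_jk; rewrite eq_sym ne_jk mulr0.
Qed.

Theorem theorem2p9 (T : nat -> nat -> rat) (hT : central_factorial2 T)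
    (r : nat) (Tr : nat -> nat -> rat) (hTr : r_central_factorial2 r Tr)
    (m n k : nat) (hmn : (m + k <= n)%N) :
  'C(m + k, m)%:R * Tr (n + r)%N (m + k + r)%N =
  \sum_(m <= l < (n - k).+1)
    'C(n, l)%:R * Tr (l + r)%N (m + r)%N * T (n - l)%N k.
Proof.
have nz i : i`!%:R != 0 :> rat by rewrite pnatr_eq0 -lt0n fact_gt0.
have TrE j i : fps_mul (fps_exp r%:R) (fps_pow fps_sinh2 j) i =
    if (j <= i)%N then j`!%:R * (Tr (i + r)%N (j + r)%N / i`!%:R) else 0.
  have := hTr j i; rewrite /fps_scale -/fps_sinh2 => /(canRL (mulKf _)) ->.
    by rewrite invrK; case: ifP; rewrite ?mulr0.
  by rewrite invr_eq0.
have := TrE (m + k)%N n; rewrite hmn.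
rewrite (@eq_fps_mul _ (fps_exp r%:R) _ _ _ (fps_powD _ m k)) // fps_mulA.
rewrite -[fps_mul _ _ n]/(\sum_(i < n.+1) fps_mul (fps_exp r%:R)
  (fps_pow fps_sinh2 m) i * fps_pow fps_sinh2 k (n - i)%N) => E.
(* Since C(m+k, m) m! k! = (m+k)!, the factor m! k! / n! turns the left side into the coefficient of
   t^n in e^(rt) f^(m+k). *)
apply: (mulfI (mulf_neq0 (mulf_neq0 (nz m) (nz k)) (invr_neq0 (nz n)))).
have -> : m`!%:R * k`!%:R / n`!%:R *
    ('C(m + k, m)%:R * Tr (n + r)%N (m + k + r)%N) =
    (m + k)`!%:R * (Tr (n + r)%N (m + k + r)%N / n`!%:R).
  by rewrite -(@bin_fact (m + k) m) ?leq_addr // addKn !natrM; field.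
rewrite -{}E mulr_sumr.
(* The sum is extended to 0 <= l <= n to match the Cauchy product, whose terms vanish for l < m (low
   order of f^m) and for l > n - k (low order of f^k). *)
rewrite (big_nat_widen _ _ n.+1) ?ltnS ?leq_subr //.
rewrite (big_nat_widenl _ 0) // big_mkcond big_mkord /=.
apply: eq_bigr => -[i /= le_in] _; rewrite ltnS in le_in.
rewrite TrE (central_factorial2_egf _ _ _ hT) ltnS.
have -> : (k <= n - i)%N = (i <= n - k)%N.
  by rewrite !leq_subRL ?(leq_trans (leq_addl m k)) // addnC.
case: (i <= n - k)%N; last by rewrite mulr0.
case: (m <= i)%N; last by rewrite mul0r.
rewrite -(bin_fact le_in) !natrM; field.
by rewrite !nz pnatr_eq0 -lt0n bin_gt0 le_in.
Qed.
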